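(* Let $G$ be a finite Abelian group and let $\upsilon:G\to\mathbb{R}$ be a nonnegative even function (that is, $\upsilon(g)\ge 0$ and $\upsilon(-g)=\upsilon(g)$ for all $g\in G$). Then the convolutional exponential $\exp^*(\upsilon)$ lies in $\bar X$, the topological closure in $\mathbb{R}^G$ of the set $X$ of all Gaussian pushforwards on $G$.
   Context: A lattice is a discrete subgroup of a finite-dimensional (real) inner product space. For a lattice $L$, define $\rho:L\to\mathbb{R}$ by $\rho(x)=e^{-\pi\langle x,x\rangle}$, and for $S\subseteq L$ write $\rho(S)=\sum_{x\in S}\rho(x)$. A function $\chi:G\to\mathbb{R}$ is a Gaussian pushforward if there exist a lattice $L$ and a group homomorphism $h:L\to G$ (not necessarily surjective) such that $\chi(g)=\rho(h^{-1}(g))$ for all $g\in G$. $X\subseteq\mathbb{R}^G$ denotes the set of all Gaussian pushforwards on $G$, and $\bar X$ its closure in the usual topology of the finite-dimensional real vector space $\mathbb{R}^G$. Convolution on $G$ is $(f_1*f_2)(g)=\sum_{g'\in G}f_1(g-g')f_2(g')$. The convolutional exponential of $\upsilon:G\to\mathbb{R}$ is $\exp^*(\upsilon)=\sum_{n=0}^\infty \upsilon^{*n}/n!$, where $\upsilon^{*n}$ is the $n$th convolutional power of $\upsilon$ and $\upsilon^{*0}=\delta$, with $\delta(0)=1$ and $\delta(x)=0$ for $x\ne0$. *)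

(* Defs.v *)
From mathcomp Require Export all_boot all_order all_algebra.
From mathcomp Require Export all_classical all_reals all_analysis.

Set Implicit Arguments.
Unset Strict Implicit.
Unset Printing Implicit Defensive.
Import Order.TTheory GRing.Theory Num.Theory.
Import numFieldNormedType.Exports.
Local Open Scope classical_set_scope.
Local Open Scope ring_scope.

Section Lattice.
Variables (R : realType) (V : vectType R) (dot : {dot V for idfun}).

Definition dist (x y : V) : R := Num.sqrt (dot (x - y) (x - y)).

Record is_lattice (L : set V) : Prop := IsLattice {
  lattice0 : L 0;
  latticeB : forall x y, L x -> L y -> L (x - y);
  lattice_discrete : forall x, L x ->
    exists2 e : R, 0 < e & forall y, L y -> dist x y < e -> y = x }.

Definition rho (x : V) : R := expR (- pi * dot x x).

(* Sums of nonnegative terms are taken in [0, +oo]. *)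
Definition rho_set (S : set V) : \bar R := \esum_(x in S) (rho x)%:E.

End Lattice.

(* A homomorphism L -> G is the restriction to L of a function h : V -> G that
   is additive on L; the values of h outside L are irrelevant. The equation
   below includes the finiteness of rho (h^-1 g), which holds for every
   lattice. *)
Definition gaussian_pushforward (R : realType) (G : finZmodType)
    (chi : G -> R) : Prop :=
  exists (V : vectType R) (dot : {dot V for idfun}) (L : set V) (h : V -> G),
    [/\ is_lattice dot L,
        {in L &, {morph h : x y / x + y}} &
        forall g, (chi g)%:E = rho_set dot (L `&` h @^-1` [set g])].

(* G is finite, so the product topology is the usual topology of R^G. *)
Definition gaussian_pushforwards (R : realType) (G : finZmodType) :
    set {ptws G -> R} :=
  [set chi | gaussian_pushforward chi].

Section Convolution.
Variables (R : realType) (G : finZmodType).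
Implicit Types f v : G -> R.

Definition conv f1 f2 : G -> R := fun g => \sum_(g' : G) f1 (g - g') * f2 g'.

Definition conv_delta : G -> R := fun g => (g == 0)%:R.

Definition conv_pow v (n : nat) : G -> R := iter n (conv v) conv_delta.

(* The limit in R^G is taken coordinate by coordinate. *)
Definition conv_exp v : G -> R :=
  fun g => limn (series (fun n => conv_pow v n g / n`!%:R)).

End Convolution.

(* Main.v *)
Require Import Defs.
From HB Require Import structures.
From mathcomp Require Import ring lra zify.
Import Order.TTheory GRing.Theory Num.Theory.
Import numFieldNormedType.Exports.
Local Open Scope classical_set_scope.
Local Open Scope ring_scope.

(** The map h(k) = k g from the one-dimensional lattice Z, with the form c x y
    where q = exp (- pi c), pushes the Gaussian forward to a function that gives
    weight q ^ (k ^ 2) to k g: it is delta + q (delta_g + delta_(-g)) plus terms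
    of order q ^ 4.  Orthogonal sums of lattices turn into convolutions of
    pushforwards ([gaussian_pushforward_conv]), so pushforwards are closed under
    convolution.  Convolving over all g, with q about v g / (2 N), gives a
    pushforward close to delta + v / N because v is even; its N-th convolution
    power is a pushforward close to (delta + v / N)^N, hence to exp* v.

    The error terms need not be estimated one by one, since everything in sight
    is nonnegative.  It suffices to bound the pushforward f from below at each
    point and to bound its total mass from above: a function that is nowhere much
    smaller than exp* v, and whose total mass is not much larger than that of
    exp* v, is close to exp* v at each point.

    - Total mass is multiplicative under convolution ([sum_conv]), and
      exp* v has total mass e^(sum v) ([sum_conv_exp]).  The mass of one factor is
      sum_k q ^ (k ^ 2) <= (1 + q) / (1 - q), which equals 1 + t for
      q = t / (2 + t).  With t = (v g + eta) / N, the N-th power of the product of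
      these factors has mass at most e^(sum (v + eta)).
    - The same q gives 2 q >= v g / N as soon as N is large with respect to
      1 / eta, so that f dominates (delta + v / N)^N
      ([pushforward_sandwich]).  By the binomial formula the latter dominates
      sum_(k < K) C(N, k) / N^k v^k for each K, and this tends to the K-th partial
      sum of exp* v when N grows ([conv_exp_approx]). *)

Set Implicit Arguments.
Unset Strict Implicit.
Unset Printing Implicit Defensive.

(** * Inner products on the line and on products *)

Lemma dot_ge0 (R : realType) (V : vectType R) (d : {dot V for idfun}) u : 0 <= d u u.
Proof.
have [->|u0] := eqVneq u 0; first by rewrite linear0l.
by rewrite ltW// neq0_dnorm_gt0.
Qed.

Section LineDot.
Variables (R : realType) (c : {posnum R}).

Definition line_dot (x y : R^o) : R := c%:num * (x * y).

Fact line_dot_bilinear : bilinear_for *%R (idfun \; *%R) line_dot.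
Proof. by split=> u a x y; rewrite /line_dot /GRing.scale /=; ring. Qed.

HB.instance Definition _ :=
  @bilinear_isBilinear.Build R R^o R^o R _ _ line_dot line_dot_bilinear.

Fact line_dot_sym x y : line_dot x y = (-1) ^+ false * idfun (line_dot y x).
Proof. by rewrite /line_dot expr0 mul1r /= [x * y]mulrC. Qed.

HB.instance Definition _ := @isHermitianSesquilinear.Build R R^o false idfun
  line_dot line_dot_sym.

Fact line_dot_gt0 (u : R^o) : u != 0 -> 0 < line_dot u u.
Proof. by move=> u0; rewrite mulr_gt0// -expr2 exprn_even_gt0. Qed.

HB.instance Definition _ := @isDotProduct.Build R R^o line_dot line_dot_gt0.

End LineDot.

Section ProdDot.
Variables (R : realType) (V1 V2 : vectType R).
Variables (d1 : {dot V1 for idfun}) (d2 : {dot V2 for idfun}).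

Definition prod_dot (x y : V1 * V2) : R := d1 x.1 y.1 + d2 x.2 y.2.

Fact prod_dot_bilinear : bilinear_for *%R (idfun \; *%R) prod_dot.
Proof.
split=> u a x y; rewrite /prod_dot /=.
  by rewrite !linearDl !linearZl_LR /=; ring.
by rewrite !linearDr !linearZr_LR /=; ring.
Qed.

HB.instance Definition _ := @bilinear_isBilinear.Build R (V1 * V2)%type
  (V1 * V2)%type R _ _ prod_dot prod_dot_bilinear.

Fact prod_dot_sym x y : prod_dot x y = (-1) ^+ false * idfun (prod_dot y x).
Proof. by rewrite /prod_dot [d1 _ _]hermC [d2 _ _]hermC /= expr0 !mul1r. Qed.

HB.instance Definition _ := @isHermitianSesquilinear.Build R (V1 * V2)%type
  false idfun prod_dot prod_dot_sym.

Fact prod_dot_gt0 u : u != 0 -> 0 < prod_dot u u.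
Proof.
case: u => x y; rewrite /prod_dot/= => xy0.
have [x0|x0] := eqVneq x 0.
  rewrite ltr_wpDl ?dot_ge0// neq0_dnorm_gt0//.
  by apply: contra_neq xy0 => ->; rewrite x0.
by rewrite ltr_pwDl ?dot_ge0// neq0_dnorm_gt0.
Qed.

HB.instance Definition _ := @isDotProduct.Build R (V1 * V2)%type prod_dot
  prod_dot_gt0.
End ProdDot.

(** * Gaussian sums and products of lattices *)

Lemma esum_fibers (R : realType) (T : choiceType) (G : finType) (h : T -> G)
    (L : set T) (a : T -> \bar R) : (forall x, 0 <= a x)%E ->
  (\esum_(x in L) a x = \sum_(g : G) \esum_(x in L `&` h @^-1` [set g]) a x)%E.
Proof.
move=> a0; under [RHS]eq_bigr do rewrite esum_mkcondr.
rewrite -esum_sum; last by move=> x g _ _; case: ifP.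
apply: eq_esum => x _; rewrite (bigD1 (h x))//= mem_set// big1 ?adde0// => g gx.
by rewrite memNset//= => xg; rewrite xg eqxx in gx.
Qed.

Lemma rho_ge0 (R : realType) (V : vectType R) (dot : {dot V for idfun}) x :
  0 <= rho dot x.
Proof. exact: expR_ge0. Qed.

Lemma ge0_esumZl (R : realType) (T : choiceType) (L : set T) (c : R)
    (a : T -> \bar R) : 0 <= c -> (forall x, 0 <= a x)%E ->
  (\esum_(x in L) (c%:E * a x) = c%:E * \esum_(x in L) a x)%E.
Proof.
move=> c0 a0; rewrite /esum -ereal_supZl//; last first.
  by apply/set0P; exists 0%E, set0; [exact: fsets_set0|rewrite fsbig_set0].
congr ereal_sup; rewrite image_comp; apply: eq_imagel => X [finX _] /=.
by rewrite !fsbig_finite//= ge0_sume_distrr.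
Qed.

Section Product.
Variables (R : realType) (V1 V2 : vectType R).
Variables (d1 : {dot V1 for idfun}) (d2 : {dot V2 for idfun}).

Lemma rho_prod_dot z : rho (prod_dot d1 d2) z = rho d1 z.1 * rho d2 z.2.
Proof. by rewrite /rho -expRD /prod_dot mulrDr. Qed.

Lemma lattice_prod (L1 : set V1) (L2 : set V2) :
  is_lattice d1 L1 -> is_lattice d2 L2 -> is_lattice (prod_dot d1 d2) (L1 `*` L2).
Proof.
move=> [z1 B1 D1] [z2 B2 D2]; split => //.
- by move=> x y [x1 x2] [y1 y2]; split; [exact: B1|exact: B2].
move=> x [x1 x2]; have [e1 e1_gt0 De1] := D1 _ x1; have [e2 e2_gt0 De2] := D2 _ x2.
exists (Num.min e1 e2); first by rewrite lt_min e1_gt0.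
move=> [y1 y2] [/= Ly1 Ly2]; rewrite lt_min => /andP[lt1 lt2].
rewrite [x]surjective_pairing; congr (_, _).
- apply: De1 => //; apply: le_lt_trans lt1; rewrite ler_sqrt ?dot_ge0//.
  by rewrite lerDl dot_ge0.
- apply: De2 => //; apply: le_lt_trans lt2; rewrite ler_sqrt ?dot_ge0//.
  by rewrite lerDr dot_ge0.
Qed.
End Product.

(** The Gaussian weight of an orthogonal sum of lattices is the product of the
    weights, and the fiber of h1 + h2 over g is the disjoint union over g' of the
    products of the fibers over g - g' and g'. *)
Lemma gaussian_pushforward_conv (R : realType) (G : finZmodType)
    (f1 f2 : G -> R) :
  gaussian_pushforward f1 -> gaussian_pushforward f2 ->
  gaussian_pushforward (conv f1 f2).
Proof.
move=> [V1 [d1 [L1 [h1 [lat1 hD1 f1E]]]]] [V2 [d2 [L2 [h2 [lat2 hD2 f2E]]]]].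
exists (V1 * V2)%type, (prod_dot d1 d2), (L1 `*` L2), (fun z => h1 z.1 + h2 z.2).
split; first exact: lattice_prod.
  move=> z w; rewrite !inE => -[z1 z2] [w1 w2] /=.
  by rewrite hD1 ?inE// hD2 ?inE// addrACA.
move=> g.
rewrite /rho_set.
rewrite (esum_fibers (fun z => h2 z.2)); last first.
  by move=> z; rewrite lee_fin rho_ge0.
rewrite /conv -sumEFin; apply: eq_bigr => g' _.
transitivity (\esum_(z in (L1 `&` h1 @^-1` [set g - g']) `*``
    (fun=> L2 `&` h2 @^-1` [set g'])) (rho d1 z.1 * rho d2 z.2)%:E); last first.
  rewrite (_ : _ `*`` _ = (L1 `*` L2) `&` (fun z => h1 z.1 + h2 z.2) @^-1` [set g]
      `&` (fun z : V1 * V2 => h2 z.2) @^-1` [set g']).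
    by apply: eq_esum => z _; rewrite rho_prod_dot.
  apply/seteqP; split => z /=.
    by move=> [[? ->] [? ->]]; split=> //; split=> //; rewrite subrK.
  by move=> [[[? ?] <-] <-]; split => //; split => //; rewrite addrK.
rewrite -(esum_esum (a := fun x y => (rho d1 x * rho d2 y)%:E)).
  under eq_esum => x _.
    rewrite (eq_esum (b := fun y => (rho d1 x)%:E * (rho d2 y)%:E))%E//.
    rewrite ge0_esumZl ?rho_ge0//; last by move=> y; rewrite lee_fin rho_ge0.
    rewrite -/(rho_set d2 _) -f2E muleC; over.
  rewrite ge0_esumZl => [|//|x]; last by rewrite lee_fin rho_ge0.
    by rewrite -/(rho_set d1 _) -f1E muleC.
  by rewrite -lee_fin f2E esum_ge0// => x _; rewrite lee_fin rho_ge0.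
by move=> x y _ _; rewrite lee_fin mulr_ge0 ?rho_ge0.
Qed.

(** * Pushforwards of one-dimensional lattices *)

Section CyclicPushforward.
Variables (R : realType) (q : R) (q_gt0 : 0 < q) (q_lt1 : q < 1).

Let theta (k : int) : R := q ^+ (`|k| ^ 2)%N.

Let theta_ge0 k : 0 <= theta k.
Proof. by rewrite exprn_ge0// ltW. Qed.

Lemma esum_geometric (a : R) : 0 <= a ->
  (\esum_(n in [set: nat]) (a * q ^+ n)%:E = (a / (1 - q))%:E)%E.
Proof.
move=> a0; rewrite -nneseries_esumT; last first.
  by move=> n; rewrite lee_fin mulr_ge0// exprn_ge0// ltW.
have q1 : `|q| < 1 by rewrite ger0_norm// ltW.
have /cvg_lim <- // := @cvg_geometric_series _ a q q1.
rewrite -EFin_lim; last exact: is_cvg_geometric_series.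
by congr (limn _); apply/funext => n /=; rewrite sumEFin.
Qed.

(** The crude bound q ^ (k ^ 2) <= q ^ |k| is exact for |k| <= 1, which is all
    that matters to first order in q. *)
Lemma esum_theta_le : (\esum_(k in [set: int]) (theta k)%:E <= ((1 + q) / (1 - q))%:E)%E.
Proof.
have [q0 q1] : 0 <= q /\ q <= 1 by split; exact: ltW.
rewrite (esumID (range Posz)) ?setTI => [|k _]; last by rewrite lee_fin.
rewrite mulrDl EFinD leeD//.
  rewrite esum_image; last by move=> m n _ _ [].
  rewrite -esum_geometric// le_esum// => n _; rewrite lee_fin mul1r /theta /=.
  by rewrite ler_wiXn2l//; case: n => // n; rewrite -mulnn leq_pmulr.
rewrite (_ : ~` _ = range Negz); last first.
  apply/seteqP; split => [[n /(_ (ex_intro2 _ _ n I erefl))//|n _]|_ [n _ <-] []//].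
  by exists n.
rewrite esum_image; last by move=> m n _ _ [].
rewrite -(esum_geometric q0) le_esum// => n _; rewrite lee_fin -exprS /theta.
by rewrite ler_wiXn2l// -mulnn leq_pmulr.
Qed.

Variables (G : finZmodType) (g : G).

Let c_gt0 : 0 < - ln q / pi :> R.
Proof. by rewrite divr_gt0 ?pi_gt0// oppr_gt0 ln_lt0// q_gt0. Qed.
(* This c makes exp (- pi c) equal to q. *)
Let c := PosNum c_gt0.

Let L : set R^o := [set` Num.int].
Let h (x : R^o) : G := g *~ Num.floor x.

Let lattice_L : is_lattice (line_dot c) L.
Proof.
split; first exact: rpred0.
  by move=> x y; exact: rpredB.
move=> x Lx; exists (Num.sqrt c%:num); first by rewrite sqrtr_gt0.
move=> y Ly; rewrite /dist /= /line_dot ltr_sqrt// gtr_pMr// -expr2.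
have /intrP[k xyk] : x - y \is a Num.int by exact: rpredB.
rewrite xyk -rmorphXn /= ltrz1 => k2.
suff k0 : k = 0 by apply/esym/eqP; rewrite -subr_eq0 xyk k0.
nia.
Qed.

Let h_morph : {in L &, {morph h : x y / x + y}}.
Proof. by move=> x y Lx Ly; rewrite /h floorDrz ?mulrzDr// -inE. Qed.

Let fiberE x : (rho_set (line_dot c) (L `&` h @^-1` [set x]) =
  \esum_(k in [set k : int | g *~ k = x]) (theta k)%:E)%E.
Proof.
rewrite (_ : _ `&` _ = [set k%:~R | k in [set k : int | g *~ k = x]]).
  rewrite /rho_set esum_image; last by move=> k l _ _ /intr_inj.
  apply: eq_esum => k _; congr EFin; rewrite /rho /theta /= /line_dot /=.
  have -> : - pi * (- ln q / pi * (k%:~R * k%:~R)) = (`|k| ^ 2)%N%:R * ln q :> R.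
    rewrite natrX natr_absz intr_norm real_normK ?num_real//.
    have := pi_gt0 R; move: pi => p p_gt0.
    by field; rewrite gt_eqF.
  by rewrite expRM_natl lnK.
apply/seteqP; split => y /=.
  by move=> [/intrP[k ->]]; rewrite /h intrKfloor => gk; exists k.
by move=> [k gk <-]; rewrite /h intrKfloor; split => //; exact: intr_int.
Qed.

(** The lower bound keeps the lattice points 0, 1 and -1 only; the two Dirac
    masses are added up when g = - g, and all three when g = 0. *)
Lemma gaussian_pushforward_cyclic : exists p : G -> R, [/\ gaussian_pushforward p,
  forall x, (x == 0)%:R + q * ((x == g)%:R + (x == - g)%:R) <= p x &
  \sum_x p x <= (1 + q) / (1 - q)].
Proof.
pose F x := rho_set (line_dot c) (L `&` h @^-1` [set x]).
have sumF : (\sum_x F x <= ((1 + q) / (1 - q))%:E)%E.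
  apply: le_trans esum_theta_le.
  rewrite (esum_fibers (fun k : int => g *~ k))//.
  by under eq_bigr do rewrite /F fiberE; under [leRHS]eq_bigr do rewrite setTI.
have F_ge0 x : (0 <= F x)%E.
  by apply: esum_ge0 => y _; rewrite lee_fin rho_ge0.
have finF x : F x \is a fin_num.
  rewrite ge0_fin_numE//; apply: le_lt_trans (ltry ((1 + q) / (1 - q))).
  by apply: le_trans sumF; rewrite (bigD1 x)//= leeDl// sume_ge0.
exists (fine \o F); split => /=.
- exists R^o, (line_dot c), L, h; split => //.
  by move=> x; rewrite fineK.
- move=> x; rewrite -lee_fin fineK// /F fiberE esum_mkcond.
  apply: esum_ge; exists [set` [:: 0; 1; -1 : int]];
    first by split => //; exact: finite_seq.
  rewrite -fsbig_seq// !big_cons big_nil /=.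
  have mem k : (k \in [set k0 : int | g *~ k0 = x]) = (x == g *~ k).
    by apply/idP/eqP; rewrite inE /= => ->.
  rewrite !mem mulr0z mulrNz mulr1z /theta /=.
  have if0 (b : bool) (r : R) : (if b then r%:E else 0%E) = (r * b%:R)%:E.
    by case: b; rewrite ?mulr1 ?mulr0.
  by rewrite !if0 adde0 -!EFinD lee_fin expr0 !expr1 mul1r mulrDr.
- rewrite -lee_fin -sumEFin (eq_bigr F)// => x _.
  by rewrite fineK.
Qed.

End CyclicPushforward.

(** * Convolution of nonnegative functions *)

Section Conv.
Variables (R : realType) (G : finZmodType).
Implicit Types (f u v : G -> R).
Local Notation delta := (@conv_delta R G).

Lemma conv_ge0 f u : (forall x, 0 <= f x) -> (forall x, 0 <= u x) ->
  forall x, 0 <= conv f u x.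
Proof. by move=> f0 u0 x; apply: sumr_ge0 => y _; rewrite mulr_ge0. Qed.

Lemma conv_delta_ge0 x : 0 <= delta x.
Proof. by rewrite ler0n. Qed.

Lemma conv_pow_ge0 v n : (forall x, 0 <= v x) -> forall x, 0 <= conv_pow v n x.
Proof.
move=> v0; elim: n => [|n IH] x /=; first exact: conv_delta_ge0.
exact: conv_ge0.
Qed.

Lemma le_conv f f' u u' :
  (forall x, 0 <= f x) -> (forall x, 0 <= u x) ->
  (forall x, f x <= f' x) -> (forall x, u x <= u' x) ->
  forall x, conv f u x <= conv f' u' x.
Proof. by move=> f0 u0 ff' uu' x; apply: ler_sum => y _; rewrite ler_pM. Qed.

Lemma le_conv_pow v v' n : (forall x, 0 <= v x) -> (forall x, v x <= v' x) ->
  forall x, conv_pow v n x <= conv_pow v' n x.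
Proof.
move=> v0 vv'; elim: n => [|n IH] x //=.
by apply: le_conv => // y; exact: conv_pow_ge0.
Qed.

Lemma sum_conv f u : \sum_x conv f u x = (\sum_x f x) * \sum_x u x.
Proof.
rewrite exchange_big mulr_sumr; apply: eq_bigr => y _ /=.
by rewrite -mulr_suml [in RHS](reindex_inj (addIr (- y))).
Qed.

Lemma sum_conv_delta : \sum_x delta x = 1.
Proof. by rewrite (bigD1 0)//= /conv_delta eqxx big1 ?addr0// => x /negPf ->. Qed.

Lemma sum_conv_pow v n : \sum_x conv_pow v n x = (\sum_x v x) ^+ n.
Proof.
by elim: n => [|n IH] /=; rewrite ?sum_conv_delta// sum_conv IH exprS.
Qed.

Lemma conv0f f : conv delta f = f.
Proof.
apply/funext => x; rewrite /conv (bigD1 x)//= /conv_delta subrr eqxx mul1r.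
by rewrite big1 ?addr0// => y /negPf yx; rewrite subr_eq0 eq_sym yx mul0r.
Qed.

Lemma convDl f u v x : conv (fun y => f y + u y) v x = conv f v x + conv u v x.
Proof. by rewrite /conv -big_split; apply: eq_bigr => y _; rewrite mulrDl. Qed.

Lemma conv_deltaDl u f x : conv (fun y => delta y + u y) f x = f x + conv u f x.
Proof. by rewrite convDl conv0f. Qed.

Lemma conv_powZ (c : R) v n x :
  conv_pow (fun y => c * v y) n x = c ^+ n * conv_pow v n x.
Proof.
elim: n x => [|n IH] x /=; first by rewrite mul1r.
rewrite /conv mulr_sumr; apply: eq_bigr => y _.
rewrite IH exprS; ring.
Qed.

Lemma conv_sumZ u n (c : 'I_n -> R) (f : 'I_n -> G -> R) x :
  conv u (fun y => \sum_(k < n) c k * f k y) x = \sum_(k < n) c k * conv u (f k) x.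
Proof.
rewrite /conv; under eq_bigr do rewrite mulr_sumr.
rewrite exchange_big; apply: eq_bigr => k _; rewrite mulr_sumr.
by apply: eq_bigr => y _ /=; rewrite mulrCA.
Qed.

(** Binomial expansion, truncated to K terms.  As an inequality it goes through
    by induction on n, Pascal's rule at each step, for every K at once: the terms
    that are cut off are nonnegative. *)
Lemma conv_pow_deltaD_ge u n K : (forall x, 0 <= u x) -> forall x,
  \sum_(k < K) 'C(n, k)%:R * conv_pow u k x <= conv_pow (fun y => delta y + u y) n x.
Proof.
move=> u0; elim: n => [|n IH] x.
  case: K => [|K]; first by rewrite big_ord0 conv_delta_ge0.
  by rewrite big_ord_recl big1 ?addr0 ?mul1r// => k _; rewrite mul0r.
rewrite [leRHS]/= conv_deltaDl.
apply: le_trans (lerD (IH x) (le_conv u0 _ (fun=> lexx _) IH x)); last first.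
  by move=> y; apply: sumr_ge0 => k _; rewrite mulr_ge0// conv_pow_ge0.
rewrite conv_sumZ -big_split /=.
case: K {IH} => [|K]; first by rewrite !big_ord0.
rewrite big_ord_recl big_split /= big_ord_recl/= -addrA !bin0 lerD2l.
under eq_bigr do rewrite binS natrD mulrDl.
rewrite big_split /= lerD2l [leRHS]big_ord_recr/= lerDl.
by rewrite mulr_ge0// (conv_ge0 u0)// => y; exact: conv_pow_ge0.
Qed.

End Conv.

(** * Pushforwards near the identity *)

Section NearDelta.
Variables (R : realType) (G : finZmodType).
Local Notation delta := (@conv_delta R G).

Lemma gaussian_pushforward_delta : gaussian_pushforward delta.
Proof.
exists R^o, (line_dot 1%:pos), [set 0], (fun=> 0); split => [|//=|g].
- split => //; first by move=> x y -> ->; rewrite subr0.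
  by move=> x ->; exists 1 => // y ->.
- by move=> x y _ _; rewrite addr0.
rewrite /rho_set /conv_delta; have [->|g0] := eqVneq g 0.
  rewrite (_ : _ `&` _ = [set 0]) ?esum_set1 ?lee_fin ?rho_ge0//.
    by rewrite /rho linear0l mulr0 expR0.
  by apply/seteqP; split => x //= -[].
rewrite (_ : _ `&` _ = set0) ?esum_set0//.
by apply/seteqP; split => x //= -[_ /esym/eqP]; rewrite (negPf g0).
Qed.

Lemma gaussian_pushforward_pow f n :
  gaussian_pushforward f -> gaussian_pushforward (conv_pow f n : G -> R).
Proof.
move=> fX; elim: n => [|n IH]; first exact: gaussian_pushforward_delta.
exact: gaussian_pushforward_conv.
Qed.

Lemma gaussian_pushforward_ge0 (f : G -> R) x :
  gaussian_pushforward f -> 0 <= f x.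
Proof.
move=> [V [d [L [h [_ _ fE]]]]].
by rewrite -lee_fin fE esum_ge0// => y _; rewrite lee_fin rho_ge0.
Qed.

(** In (delta + a) * (delta + b) >= delta + a + b, the cross term a * b is
    dropped. *)
Lemma pushforward_near_delta (q : G -> R) (s : seq G) :
  (forall g, 0 < q g < 1) ->
  exists f : G -> R, [/\ gaussian_pushforward f,
    forall x, delta x + \sum_(g <- s) q g * ((x == g)%:R + (x == - g)%:R) <= f x &
    \sum_x f x <= \prod_(g <- s) ((1 + q g) / (1 - q g))].
Proof.
move=> q01; elim: s => [|g s [f [fX f_ge f_le]]].
  exists delta; split; first exact: gaussian_pushforward_delta.
    by move=> x; rewrite big_nil addr0.
  by rewrite big_nil sum_conv_delta.
have /andP[q0 q1] := q01 g.
have [p [pX p_ge p_le]] := gaussian_pushforward_cyclic q0 q1 g.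
exists (conv p f); split; first exact: gaussian_pushforward_conv.
  move=> x; rewrite big_cons.
  pose a y := q g * ((y == g)%:R + (y == - g)%:R).
  have a0 y : 0 <= a y by rewrite mulr_ge0 ?addr_ge0// ltW.
  pose b y := \sum_(g <- s) q g * ((y == g)%:R + (y == - g)%:R).
  have b0 y : 0 <= b y.
    apply: sumr_ge0 => g' _; rewrite mulr_ge0 ?addr_ge0//.
    by have /andP[/ltW] := q01 g'.
  apply: (@le_trans _ _ (conv (fun y => delta y + a y) (fun y => delta y + b y) x)).
    rewrite conv_deltaDl -/(a x) -/(b x) [a x + _]addrC addrA lerD2l.
    apply: (@le_trans _ _ (conv a delta x)).
      rewrite /conv (bigD1 0)//= /conv_delta eqxx subr0 mulr1 lerDl.
      by apply: sumr_ge0 => y _; rewrite mulr_ge0.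
    by apply: le_conv => // y; rewrite ?conv_delta_ge0// lerDl.
  by apply: le_conv => // y; rewrite addr_ge0 ?conv_delta_ge0.
rewrite sum_conv big_cons ler_pM// sumr_ge0// => y _;
  exact: gaussian_pushforward_ge0.
Qed.

End NearDelta.

(** * The convolutional exponential *)

Section ConvExp.
Variables (R : realType) (G : finZmodType) (v : G -> R).
Hypothesis v_ge0 : forall g, 0 <= v g.

(** Each coordinate is dominated by the total mass, whose series is that of the
    real exponential. *)
Lemma is_cvg_conv_exp g : cvgn (series (fun n => conv_pow v n g / n`!%:R)).
Proof.
apply: series_le_cvg (is_cvg_series_exp_coeff (\sum_x v x)) => n.
- by rewrite divr_ge0// conv_pow_ge0.
- by rewrite /exp_coeff /= divr_ge0// exprn_ge0// sumr_ge0.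
rewrite /exp_coeff/= ler_pM2r ?invr_gt0 ?ltr0n ?fact_gt0// -sum_conv_pow.
by rewrite (bigD1 g)//= lerDl sumr_ge0// => x _; rewrite conv_pow_ge0.
Qed.

Lemma sum_conv_exp : \sum_g conv_exp v g = expR (\sum_g v g).
Proof.
apply/esym/cvg_lim => //.
rewrite (_ : series _ = fun K => \sum_g series (fun n => conv_pow v n g / n`!%:R) K).
  by apply: cvg_big => [|g _]; [exact: add_continuous|exact: is_cvg_conv_exp].
apply/funext => K; rewrite /series /= exchange_big /=; apply: eq_bigr => n _.
by rewrite /exp_coeff /= -sum_conv_pow mulr_suml.
Qed.

End ConvExp.

Lemma cvg_binomial_ratio (R : realType) k :
  ('C(n.+1, k)%:R / n.+1%:R ^+ k : R) @[n --> \oo] --> (k`!%:R^-1 : R).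
Proof.
have ffact_ratio : ((n.+1 ^_ k)%:R / n.+1%:R ^+ k : R) @[n --> \oo] --> (1 : R).
  elim: k => [|k IH].
    by under eq_fun do rewrite divr1; exact: cvg_cst.
  have h : (1 - k%:R * harmonic n : R) @[n --> \oo] --> (1 - k%:R * 0 : R).
    apply: cvgB; first exact: cvg_cst.
    apply: cvgM; first exact: cvg_cst.
    exact: cvg_harmonic.
  rewrite mulr0 subr0 in h.
  rewrite -[1 in X in _ --> X]mulr1.
  apply: cvg_trans (cvgM IH h); apply: near_eq_cvg; near=> n.
  have kn : (k < n.+1)%N by near: n; exact: nbhs_infty_ge.
  rewrite ffactnSr natrM natrB ?(ltnW kn)// exprS /harmonic /=.
  by field; rewrite expf_neq0 ?nat1r ?pnatr_eq0.
rewrite -[X in _ --> X]mul1r.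
rewrite (_ : (fun n => _) = fun n => (n.+1 ^_ k)%:R / n.+1%:R ^+ k * k`!%:R^-1 : R).
  by apply: cvgM; [exact: ffact_ratio|exact: cvg_cst].
apply/funext => n; rewrite mulrAC; congr (_ / _).
by rewrite -bin_ffact natrM mulfK// pnatr_eq0 -lt0n fact_gt0.
Unshelve. all: by end_near. Qed.

(** First a partial sum of exp* v is taken within e / 2 of its limit; with that
    number K of terms fixed, n then grows. *)
Lemma conv_exp_approx (R : realType) (G : finZmodType) (v : G -> R)
    (v_ge0 : forall g : G, 0 <= v g) (e : R) : 0 < e ->
  \forall n \near \oo, forall g, conv_exp v g - e <=
    conv_pow (fun y => conv_delta R y + n.+1%:R^-1 * v y) n.+1 g.
Proof.
move=> e0; have e2 : 0 < e / 2 by rewrite divr_gt0.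
have [K _ /(_ K (leqnn K)) KE] : \forall K \near \oo, forall g,
    conv_exp v g - e / 2 <= series (fun k => conv_pow v k g / k`!%:R) K.
  apply: filter_forall => g.
  have /cvgrPdist_le/(_ _ e2) := is_cvg_conv_exp v_ge0 (g := g).
  apply: filterS => K; rewrite ler_distlC => /andP[+ _].
  by rewrite /conv_exp lerBlDr.
have : \forall n \near \oo, forall g,
    series (fun k => conv_pow v k g / k`!%:R) K - e / 2 <=
    \sum_(k < K) 'C(n.+1, k)%:R * conv_pow (fun y => n.+1%:R^-1 * v y) k g.
  apply: filter_forall => g.
  have : \sum_(k < K) 'C(n.+1, k)%:R * conv_pow (fun y => n.+1%:R^-1 * v y) k g
      @[n --> \oo] --> \sum_(k < K) k`!%:R^-1 * conv_pow v k g.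
    apply: cvg_big => [|k _]; first exact: add_continuous.
    under eq_fun do rewrite conv_powZ exprVn mulrA.
    by apply: cvgM; [exact: cvg_binomial_ratio|exact: cvg_cst].
  move=> /cvgrPdist_le/(_ _ e2); apply: filterS => n; rewrite ler_distlC => /andP[+ _].
  rewrite /series /= big_mkord; under [X in _ -> X - _ <= _]eq_bigr do rewrite mulrC.
  by [].
apply: filterS => n nE g; have u0 y : 0 <= n.+1%:R^-1 * v y by rewrite mulr_ge0.
by have := conv_pow_deltaD_ge n.+1 K u0 g; have := nE g; have := KE g; lra.
Qed.

(** * Approximation by pushforwards *)

(** The margin eta makes room for the loss in 2 q < t, where t = 2 q / (1 - q):
    it keeps 2 q above v / n.+1 once n is large, at the price of a factor
    e^(#|G| eta) in the total mass. *)
Lemma pushforward_sandwich (R : realType) (G : finZmodType) (v : G -> R)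
    (eta : R) (n : nat) :
  (forall g, 0 <= v g) -> (forall g, v (- g) = v g) -> 0 < eta ->
  (forall g, v g * (v g + eta) <= 2 * eta * n.+1%:R) ->
  exists f : G -> R, [/\ gaussian_pushforward f,
    forall x, conv_pow (fun y => conv_delta R y + n.+1%:R^-1 * v y) n.+1 x <= f x &
    \sum_x f x <= expR (\sum_g (v g + eta))].
Proof.
move=> v0 v_even eta0 nbig.
set N : R := n.+1%:R; have N0 : 0 < N by rewrite ltr0n.
pose t g := (v g + eta) / N.
have t0 g : 0 < t g by rewrite divr_gt0// ltr_wpDl.
(* The solution of (1 + q) / (1 - q) = 1 + t. *)
pose q g := t g / (2 + t g).
have q01 g : 0 < q g < 1.
  have tg0 := t0 g; have tg2 : 0 < 2 + t g by lra.
  by rewrite divr_gt0//= ltr_pdivrMr// mul1r ltrDr.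
have [f [fX f_ge f_le]] := pushforward_near_delta (index_enum G) q01.
have f0 x := gaussian_pushforward_ge0 x fX.
exists (conv_pow f n.+1); split.
- exact: gaussian_pushforward_pow.
- apply: le_conv_pow => [x|x].
    by rewrite addr_ge0 ?conv_delta_ge0// mulr_ge0// ltW// invr_gt0.
  apply: le_trans (f_ge x); rewrite lerD2l.
  (* The sum is q x + q (- x), which is 2 q x as v is even. *)
  rewrite (eq_bigr (fun g => q g * (x == g)%:R + q g * (x == - g)%:R)); last first.
    by move=> g _; rewrite mulrDr.
  rewrite big_split /= (bigD1 x)//= eqxx big1 ?addr0; last first.
    by move=> g /negPf; rewrite eq_sym => ->; rewrite mulr0.
  rewrite (bigD1 (- x))//= opprK eqxx big1 ?addr0; last first.
    by move=> g /negPf; rewrite -eqr_oppLR eq_sym => ->; rewrite mulr0.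
  rewrite /q /t v_even !mulr1.
  have w0 : 0 < v x + eta by rewrite ltr_wpDl.
  rewrite (_ : _ + _ = 2 * (v x + eta) / (2 * N + (v x + eta))); last first.
    by field; lra.
  rewrite mulrC ler_pdivrMr// mulrAC ler_pdivlMr; last by lra.
  have := nbig x; rewrite -/N; nra.
rewrite sum_conv_pow.
have : \sum_x f x <= expR ((\sum_g (v g + eta)) / N).
  apply: le_trans f_le _; rewrite mulr_suml expR_sum; apply: ler_prod => g _.
  rewrite (_ : _ / _ = 1 + t g); last first.
    by have tg := t0 g; rewrite /q; field; apply/andP; split; lra.
  by rewrite addr_ge0 ?(ltW (t0 g))//= expR_ge1Dx.
move=> sum_f.
rewrite -[X in expR X](divfK (lt0r_neq0 N0)) expRM_natr.
by rewrite lerXn2r// nnegrE ?expR_ge0 ?sumr_ge0.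
Qed.

Lemma closure_ptws (R : realType) (G : finZmodType) (A : set {ptws G -> R})
    (f : G -> R) :
  (forall e : R, 0 < e -> exists2 u, A u & forall g, `|f g - u g| < e) ->
  closure A f.
Proof.
move=> Af.
have /choice[u uP] : forall n : nat, exists u : {ptws G -> R}, A u /\
    forall g, `|f g - u g| < n.+1%:R^-1.
  by move=> n; have [u ? ?] := Af n.+1%:R^-1 ltac:(by []); exists u.
have uf : {ptws, u @ \oo --> f}.
  apply/cvg_sup => g U [_ [[W oW <-] /= Wf] WU]; apply: filterS WU _.
  suff : u n g @[n --> \oo] --> f g by apply; exact: open_nbhs_nbhs.
  apply/cvgrPdist_lt => e e0; near=> n; apply: (lt_trans ((uP n).2 g)).
  by near: n; exact: (near_infty_natSinv_lt (PosNum e0)).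
move=> B /uf [n _ /(_ n (leqnn n))] Bn; exists (u n); split => //.
by have [] := uP n.
Unshelve. all: by end_near. Qed.

Unset Implicit Arguments.

Theorem theorem3p8 (R : realType) (G : finZmodType) (v : G -> R)
    (v_ge0 : forall g : G, 0 <= v g)
    (v_even : forall g : G, v (- g) = v g) :
  closure (@gaussian_pushforwards R G) (conv_exp v).
Proof.
apply: closure_ptws => e e0.
set s := \sum_g v g; pose d := e / (#|G|.+1)%:R.
have d0 : 0 < d by rewrite divr_gt0.
have G0 : (0 < #|G|)%N by apply/card_gt0P; exists 0.
have [eta eta0 sum_eta] : exists2 eta : R, 0 < eta &
    expR (\sum_g (v g + eta)) = \sum_g conv_exp v g + d.
  have r0 : 0 < d / expR s by rewrite divr_gt0// expR_gt0.
  (* The solution of e^s * e^(#|G| eta) = e^s + d. *)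
  exists (ln (1 + d / expR s) / #|G|%:R).
    by rewrite divr_gt0 ?ltr0n// ln_gt0// ltrDl.
  rewrite big_split sumr_const /= -[_ *+ _](mulr_natr (_ / _)) divfK;
    last by rewrite pnatr_eq0 -lt0n.
  rewrite expRD.
  rewrite lnK ?posrE ?addr_gt0// sum_conv_exp// mulrDr mulr1 [X in _ + X]mulrC.
  by rewrite divfK// gt_eqF// expR_gt0.
have [n _ /(_ n (leqnn n)) [n_big n_approx]] : \forall n \near \oo,
    (forall g, v g * (v g + eta) <= 2 * eta * n.+1%:R) /\
    (forall g, conv_exp v g - d <=
    conv_pow (fun y => conv_delta R y + n.+1%:R^-1 * v y) n.+1 g).
  near=> n; split; last by near: n; exact: conv_exp_approx.
  near: n; apply: filter_forall => g; near=> n.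
  rewrite -ler_pdivrMl ?mulr_gt0//; apply: (@le_trans _ _ n%:R).
    by near: n; exact: nbhs_infty_ger.
  by rewrite ler_nat.
have [f [fX f_ge f_le]] := pushforward_sandwich v_ge0 v_even eta0 n_big.
exists f => // g.
have f_ge' x : conv_exp v x - d <= f x := le_trans (n_approx x) (f_ge x).
(* The nonnegative excesses of f over exp* v - d add up to at most
   #|G|.+1 d, so each of them is at most that. *)
have f_g : f g - (conv_exp v g - d) <= (#|G|.+1)%:R * d.
  have : \sum_x (f x - (conv_exp v x - d)) <= (#|G|.+1)%:R * d.
    rewrite !sumrB sumr_const -mulr_natl -nat1r; move: f_le; rewrite sum_eta; lra.
  apply: le_trans; rewrite (bigD1 g)//= lerDl sumr_ge0// => x _.
  by rewrite subr_ge0.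
have dE : (#|G|.+1)%:R * d = e by rewrite mulrC divfK.
have := f_ge' g; have : d < e.
  by rewrite ltr_pdivrMr// ltr_pMr// ltr1n.
by rewrite ltr_distlC; move: f_g; rewrite dE; lra.
Unshelve. all: by end_near. Qed.
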